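(* There exists (in ZFC) a subspace $X\subseteq[0,1]$ which is not Polish and such that the hyperspace $K(X)$ is hereditarily Baire.
   Context: $K(X)$ denotes the space of all nonempty compact subsets of $X$ with the Vietoris topology, whose basic open sets are $\langle U_0,\dots,U_n\rangle=\{K\in K(X): K\subseteq\bigcup_{i\le n}U_i \text{ and } K\cap U_i\ne\emptyset \text{ for every } i\le n\}$, with each $U_i$ open in $X$. A topological space is Baire if the intersection of every countable family of open dense subsets is dense; it is hereditarily Baire if every closed subspace is Baire. A space is Polish if it is separable and completely metrizable. *)

(* Defs.v *)
From HB Require Import structures.
From mathcomp Require Import all_boot all_order all_algebra.
From mathcomp Require Import all_classical all_reals.
From mathcomp Require Import topology normedtype.

Set Implicit Arguments.
Unset Strict Implicit.
Unset Printing Implicit Defensive.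

Import Order.TTheory GRing.Theory Num.Theory.
Import numFieldNormedType.Exports.

Local Open Scope classical_set_scope.

Definition hyperspace (T : topologicalType) : Type :=
  set_type [set K : set T | compact K /\ K !=set0].

(* The basic Vietoris set <U 0, ..., U n>. *)
Definition vietoris_base (T : topologicalType) (n : nat) (U : nat -> set T)
    : set (hyperspace T) :=
  [set K | set_val K `<=` \bigcup_(i in [set i | (i <= n)%N]) U i /\
           forall i, (i <= n)%N -> set_val K `&` U i !=set0].

Section vietoris_topology.
Variable T : topologicalType.

Let D : set (nat * (nat -> set T)) :=
  [set nU | forall i, (i <= nU.1)%N -> open (nU.2 i)].
Let b (nU : nat * (nat -> set T)) : set (hyperspace T) :=
  vietoris_base nU.1 nU.2.

Let b_cover : \bigcup_(i in D) b i = setT.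
Proof.
apply/seteqP; split=> // K _; exists (0%N, fun=> setT).
  by move=> i _; exact: openT.
split=> [x _|i _]; first by exists 0%N.
by rewrite setIT; have /set_mem[] := valP K.
Qed.

Let b_join i j t : D i -> D j -> b i t -> b j t ->
  exists k, [/\ D k, b k t & b k `<=` b i `&` b j].
Proof.
case: i j => [n U] [m V] /= DU DV [tU tUi] [tV tVi].
set uU := \bigcup_(i in [set i | (i <= n)%N]) U i.
set uV := \bigcup_(i in [set i | (i <= m)%N]) V i.
have ouU : open uU by apply: bigcup_open => i; exact: DU.
have ouV : open uV by apply: bigcup_open => i; exact: DV.
pose W k := if (k <= n)%N then U k `&` uV else V (k - n.+1)%N `&` uU.
have Wl k : (k <= n)%N -> W k = U k `&` uV by rewrite /W => ->.
have Wr k : W (k + n.+1)%N = V k `&` uU.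
  by rewrite /W leqNgt (leq_addl k n.+1) addnK.
exists ((m + n.+1)%N, W); split.
- move=> k /= km; rewrite /W; case: leqP => kn; apply: openI => //.
  + exact: DU.
  + by apply: DV => /=; rewrite leq_subLR addnC.
- split=> [x tx|k km] /=.
    have [i /= i_n Ux] := tU _ tx; exists i => /=.
      by rewrite (leq_trans i_n)// (leq_trans (leqnSn n))// leq_addl.
    by rewrite Wl//; split=> //; exact: tV.
  rewrite /W; case: leqP => kn.
    by have [x [tx Ux]] := tUi k kn; exists x; split=> //; split=> //; exact: tV.
  have [|x [tx Vx]] := tVi (k - n.+1)%N; first by rewrite leq_subLR addnC.
  by exists x; split=> //; split=> //; exact: tU.
- move=> K [/= KW KWi]; split; split=> /=.
  + move=> x /KW[k _]; rewrite /W; case: leqP => kn [].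
      by move=> Ux _; exists k.
    by [].
  + move=> k kn; have [|x []] := KWi k.
      by rewrite (leq_trans kn)// (leq_trans (leqnSn n))// leq_addl.
    by rewrite Wl// => Kx [Ux _]; exists x.
  + move=> x /KW[k /= km]; rewrite /W; case: leqP => kn []; first by [].
    by move=> Vx _; exists (k - n.+1)%N => //=; rewrite leq_subLR addnC.
  + move=> k km; have [|x []] := KWi (k + n.+1)%N; first by rewrite leq_add2r.
    by rewrite Wr => Kx [Vx _]; exists x.
Qed.

HB.instance Definition _ := Choice.on (hyperspace T).
HB.instance Definition _ :=
  isBaseTopological.Build (hyperspace T) b_cover b_join.

Lemma open_vietoris (A : set (hyperspace T)) :
  open A <-> forall K, A K -> exists n U,
    [/\ forall i, (i <= n)%N -> open (U i),
        vietoris_base n U K & vietoris_base n U `<=` A].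
Proof.
split=> [[D' D'D <-] K [[n U] D'U KU]|AP].
  exists n, U; split=> //; first exact: (D'D _ D'U).
  by move=> L LU; exists (n, U).
exists [set nU | D nU /\ b nU `<=` A]; first by move=> nU [].
apply/seteqP; split=> [K [nU [_ nUA]] /nUA//|K /AP[n [U [oU KU UA]]]].
by exists (n, U).
Qed.

End vietoris_topology.

Definition baire_space (T : topologicalType) :=
  forall F : set (set T), countable F ->
    (forall U, F U -> open U /\ dense U) -> dense (\bigcap_(U in F) U).

Definition hereditarily_baire (T : topologicalType) :=
  forall C : set T, closed C -> baire_space (set_type C).

Definition separable (T : topologicalType) :=
  exists2 D : set T, countable D & dense D.

Definition homeomorphic (S T : topologicalType) :=
  exists (f : S -> T) (g : T -> S),
    [/\ cancel f g, cancel g f, continuous f & continuous g].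

(* The library's complete spaces are pointed; this version allows the empty
   space. *)
Definition complete_metric (R : realType) (M : metricType R) :=
  forall F : set_system M, ProperFilter F -> cauchy F ->
    exists x : M, F --> x.

Definition completely_metrizable (R : realType) (T : topologicalType) :=
  exists2 M : metricType R, complete_metric M & homeomorphic T M.

Definition polish (R : realType) (T : topologicalType) :=
  separable T /\ completely_metrizable R T.

(* Main.v *)
(* Let Y be a Menger subset of [0,1] that is not sigma-compact, and let
   X = [0,1] \ Y. If X were Polish it would be a G_delta set, hence Y would be
   sigma-compact.

   Given a closed C in K(X) and dense open sets G_n in C, build a tree of
   elements K_s of C, s a finite sequence of naturals, where K_(s j) is at
   Hausdorff distance less than 1/j from K_s and lies well inside G_|s|. Every
   K_s is disjoint from Y, so a point y of Y is far from all but finitely many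
   children of each K_s. As in Hurewicz's analysis of the Menger game, the
   Menger property of Y yields one branch g which every y of Y leaves in this
   sense at some level, so the Hausdorff limit of the K_(g|n) misses Y: it is an
   element of K(X), hence of C, and it lies in every G_n.

   Y consists of the rationals q_n of [0,1] and points x_c indexed by the least
   initial segment I of a well-order on Baire space that carries a dominating
   family f; x_c avoids the closed sets {x : |x - q_n| >= 1/(f_b(n)+1) for all
   n}, b < c, which is possible by the same branch argument. A closed set
   missing the rationals lies in one of these sets, so it contains few of the
   x_c, and this makes Y Menger. If Y were a countable union of closed sets, one
   of them would contain many x_c, and a Cantor scheme inside it, avoiding the
   rationals, would produce a closed set missing the rationals with continuum
   many x_c. *)

Require Import Defs.
From HB Require Import structures.
From mathcomp Require Import all_boot all_order all_algebra.
From mathcomp Require Import all_classical all_reals.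
From mathcomp Require Import topology normedtype.
From mathcomp Require Import lra.
From mathcomp Require wochoice.

Set Implicit Arguments.
Unset Strict Implicit.
Unset Printing Implicit Defensive.

Import Order.TTheory GRing.Theory Num.Theory.
Import numFieldNormedType.Exports.

Local Open Scope classical_set_scope.
Local Open Scope ring_scope.

(** * Selection principles and branches of trees *)

(* The Menger property relative to a class [O] of open sets. Covers may be taken
   increasing because the Menger property selects finite subfamilies. *)
Definition selective (T : Type) (O : set (set T)) (A : set T) :=
  forall U : nat -> nat -> set T,
    (forall n k, O (U n k)) ->
    (forall n j k, (j <= k)%N -> U n j `<=` U n k) ->
    (forall n, A `<=` \bigcup_k U n k) ->
    exists g : nat -> nat, A `<=` \bigcup_n U n (g n).

Definition menger (T : topologicalType) (A : set T) := selective open A.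

(* [small A] holds iff the cardinality of [A] is less than the dominating
   number. *)
Definition small (T : Type) (A : set T) :=
  forall f : T -> nat -> nat, exists g : nat -> nat,
    forall x, A x -> exists n, (f x n <= g n)%N.

Section selective_branch.
Variables (T : Type) (O : set (set T)) (A : set T).
Variable N : seq nat -> nat -> set T.
Hypothesis OT : O setT.
Hypothesis OI : forall U V, O U -> O V -> O (U `&` V).
Hypothesis OU : forall F : nat -> set T, (forall n, O (F n)) ->
  O (\bigcup_n F n).
Hypothesis selA : selective O A.
Hypothesis ON : forall s k, O (N s k).
Hypothesis monoN : forall s j k, (j <= k)%N -> N s j `<=` N s k.
Hypothesis coverN : forall s, A `<=` \bigcup_k N s k.

(* [level n k] holds at [y] when [y] has bounds [k_0 <= ... <= k_n <= k] such
   that [N s k_m y] for all [s] of length [m] with entries below [k_(m-1)]. *)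
Fixpoint level n k : set T :=
  if n is m.+1 then
    \bigcup_j (level m (minn j k) `&`
      \bigcap_(s in [set: m.+1.-tuple 'I_(minn j k)])
        N [seq val i | i <- s] k)
  else N [::] k.

Lemma levelO n k : O (level n k).
Proof.
elim: n k => [|n IHn] k //=; apply: OU => j; apply: OI => //.
set J := [set: _]; have -> : J = [set` enum {: n.+1.-tuple 'I_(minn j k)}].
  by apply/seteqP; split=> s //= _; rewrite mem_enum.
by rewrite bigcap_seq; elim/big_ind: _ => // *; exact: OI.
Qed.

Lemma level_mono n j k : (j <= k)%N -> level n j `<=` level n k.
Proof.
case: n => [|n] /= jk; first exact: monoN.
move=> y [i _ [yi yN]]; exists (minn i j) => //.
have -> : minn (minn i j) k = minn i j by rewrite -minnA (minn_idPl jk).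
by split=> // s _; apply: monoN jk _ _; exact: yN.
Qed.

Lemma level_cover n : A `<=` \bigcup_k level n k.
Proof.
elim: n => [|n IHn] y Ay /=; first exact: coverN.
have [j _ yj] := IHn y Ay.
have /choice[c yc] s : exists k, N s k y.
  by have [k _ ?] := coverN s Ay; exists k.
(* Only finitely many positions of length [n.+1] have entries below [j], so one bound serves them
   all. *)
pose k := (\max_(s : n.+1.-tuple 'I_j) c (map val s))%N.
exists (maxn j k) => //; exists j => //.
have -> : minn j (maxn j k) = j by rewrite (minn_idPl _)// leq_maxl.
split=> // s _; apply: monoN (yc _); apply: leq_trans (leq_maxr _ _).
exact: (@leq_bigmax _ (fun s : n.+1.-tuple 'I_j => c (map val s))).
Qed.

(** Selectivity is applied to the sets [level n k], and the branch [h] consists of the partial sums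
    of the selector. For [y] in [A], take the least [n] with [level n (h n) y]. If [n > 0],
    minimality puts the earlier values of [h] below the bound used one level down, so [mkseq h n] is
    among the positions that [level n] quantifies over. *)
Lemma selective_branch :
  exists g : nat -> nat, forall y, A y -> exists n, N (mkseq g n) (g n) y.
Proof.
have [g gA] := selA levelO level_mono level_cover.
pose h n := (\sum_(i < n.+1) g i)%N.
have hS n : h n.+1 = (h n + g n.+1)%N by rewrite /h big_ord_recr.
have gh n : (g n <= h n)%N by rewrite /h big_ord_recr leq_addl.
have hmono i j : (i <= j)%N -> (h i <= h j)%N.
  move=> /subnKC <-; elim: (j - i)%N => [|d IH]; first by rewrite addn0.
  by rewrite addnS hS (leq_trans IH)// leq_addr.
exists h => y Ay.
have ex : exists n, `[< level n (h n) y >].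
  by have [n _ yn] := gA y Ay; exists n; apply/asboolP; exact: level_mono yn.
case: (ex_minnP ex) => -[|n] /asboolP /= yn nmin; first by exists 0%N.
exists n.+1; case: yn => j _ [yj yN].
have lth i : (i < n.+1)%N -> (h i < minn j (h n.+1))%N.
  move=> lein; rewrite ltnNge; apply/negP => le_h.
  suff : (n.+1 <= n)%N by rewrite ltnn.
  apply: nmin; apply/asboolP; apply: level_mono yj.
  by apply: leq_trans le_h _; exact: hmono.
have := yN (mktuple (fun i : 'I_n.+1 => Ordinal (lth i (ltn_ord i)))) I.
by rewrite -map_comp /= /mkseq -val_enum_ord -map_comp.
Qed.
End selective_branch.

(** * The sigma-ideal of small sets *)

(** With all sets in the role of open sets, [selective_branch] also applies to small index sets.
    Each point records indices at which it is covered, and a [g] that reaches this record at one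
    coordinate selects a set containing the point. *)
Lemma small_selective (T : Type) (A : set T) : small A -> selective setT A.
Proof.
move=> smA U _ monoU coverU.
have /choice[f fP] x : exists f : nat -> nat, A x -> forall n, U n (f n) x.
  have [Ax|nAx] := pselect (A x); last by exists (fun=> 0%N).
  have /choice[f fU] n : exists k, U n k x.
    by have [k _ Uk] := coverU n x Ax; exists k.
  by exists f.
have [g gP] := smA f; exists g => x Ax.
by have [n fg] := gP x Ax; exists n => //; exact: monoU fg _ (fP x Ax n).
Qed.

Lemma sub_small (T : Type) (A B : set T) : A `<=` B -> small B -> small A.
Proof.
by move=> AB smB f; have [g gP] := smB f; exists g => x /AB; exact: gP.
Qed.

Lemma small1 (T : Type) (x : T) : small [set x].
Proof. by move=> f; exists (f x) => _ ->; exists 0%N. Qed.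

(** Pairing splits the coordinates into countably many rows; row [m] carries the bound for [A m]. *)
Lemma small_bigcup (T : Type) (A : nat -> set T) :
  (forall m, small (A m)) -> small (\bigcup_m A m).
Proof.
move=> smA f.
have /choice[g gP] m : exists g : nat -> nat, forall x, A m x ->
    exists n, (f x (pickle (m, n)) <= g n)%N.
  exact: smA (fun x n => f x (pickle (m, n))).
exists (fun n => if unpickle n is Some p then g p.1 p.2 else 0%N).
move=> x [m _ Amx]; have [n fg] := gP m x Amx.
by exists (pickle (m, n)); rewrite pickleK.
Qed.

Lemma smallU (T : Type) (A B : set T) : small A -> small B -> small (A `|` B).
Proof.
move=> smA smB; have : small (\bigcup_n (if n is 0%N then A else B)).
  by apply: small_bigcup => -[|n].
by apply: sub_small => x [Ax|Bx]; [exists 0%N | exists 1%N].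
Qed.

(** * Open and closed sets of reals in epsilon form *)

Section real_topology.
Variable R : realType.
Implicit Types (U C : set R) (x e : R).

Lemma openRP U : open U <->
  forall x, U x -> exists2 e : R, 0 < e & forall y, `|x - y| < e -> U y.
Proof.
rewrite openE; split=> [oU x /oU /nbhs_ballP[e e0 eU]|oU x /oU[e e0 eU]].
  by exists e => // y xy; apply: eU; rewrite -ball_normE.
by apply/nbhs_ballP; exists e => // y; rewrite -ball_normE => /eU.
Qed.

Lemma closedRP C : closed C <->
  forall x, ~ C x -> exists2 e : R, 0 < e & forall y, `|x - y| < e -> ~ C y.
Proof. by rewrite -openC; exact: openRP. Qed.

Definition natSinv (k : nat) : R := k.+1%:R^-1.

Lemma natSinv_lt e : 0 < e -> exists k, natSinv k < e.
Proof. by move=> /ltr_add_invr[k]; rewrite add0r; exists k. Qed.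

Lemma natSinv_gt0 k : 0 < natSinv k.
Proof. by rewrite invr_gt0. Qed.

Lemma natSinv_le j k : (j <= k)%N -> natSinv k <= natSinv j.
Proof. by move=> jk; rewrite lef_pV2 ?posrE// ler_nat. Qed.

End real_topology.

(** * Avoiding a small family of closed sets *)

Section small_avoid.
Variables (R : realType) (q : nat -> R).
Hypothesis q_dense :
  forall a b : R, 0 <= a -> a < b -> b <= 1 -> exists2 n, a < q n & q n < b.
Variables (T : Type) (J : set T) (C : T -> set R).
Hypothesis smJ : small J.
Hypothesis closedC : forall b, J b -> closed (C b).
Hypothesis Cq : forall b n, J b -> ~ C b (q n).

(** [(n, (c, r))] codes stage [n] and the interval from [c] to [c + r]. Its left endpoint is a term
    of [q], hence outside every [C b] with [b] in [J]. *)
Let good (p : nat * (R * R)) :=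
  [/\ 0 <= p.2.1, 0 < p.2.2, p.2.1 + p.2.2 <= 1 & exists m, p.2.1 = q m].

Lemma small_avoid_step p j : exists p', good p ->
  [/\ good p', p'.1 = p.1.+1, p.2.1 < p'.2.1,
      p'.2.1 + p'.2.2 < p.2.1 + Num.min p.2.2 (natSinv R j) &
      q p.1 < p'.2.1 \/ p'.2.1 + p'.2.2 < q p.1].
Proof.
case: p => n [c r] /=.
have [gp|ngp] := pselect (good (n, (c, r))); last by exists (n, (c, r)) => /ngp.
case: (gp) => /= c0 r0 cr1 _; have j0 := @natSinv_gt0 R j.
pose m := c + Num.min r (natSinv R j).
have cm : c < m by rewrite /m ltrDl lt_min r0.
have m1 : m <= 1 by rewrite (le_trans _ cr1)// lerD2l ge_min lexx.
have [d cd [dm qd]] : exists2 d, c < d & d <= m /\ (q n <= c \/ d <= q n).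
  have [qc|cq] := leP (q n) c; first by exists m => //; split; [|left].
  have [mq|qm] := leP m (q n); first by exists m => //; split; [|right].
  by exists (q n) => //; split; [exact: ltW|right].
have [i ci id] := q_dense c0 cd (le_trans dm m1).
(* An interval strictly between [c] and [d] misses [q n]; halving the length keeps the right
   endpoint below [d]. *)
exists (n.+1, (q i, (d - q i) / 2)) => _; split => //=.
- split=> /=; [lra|lra|lra|by exists i].
- by rewrite -/m; lra.
- by case: qd => ?; [left|right]; lra.
Qed.

(** Move [j] keeps the next interval within [natSinv R j] of the current left endpoint. As [C b] is
    closed and misses that endpoint, all large moves avoid it; since [J] is small,
    [selective_branch] gives one branch that escapes each [C b] at some stage. *)
Lemma small_avoid :
  exists x : R, [/\ 0 <= x <= 1, forall n, x != q n & forall b, J b -> ~ C b x].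
Proof.
have /choice[nxt nxtP] : forall pj : (nat * (R * R)) * nat, exists p', _ :=
  fun pj => small_avoid_step pj.1 pj.2.
have [i0 i00 i01] := q_dense (lexx 0) ltr01 (lexx 1).
pose p0 : nat * (R * R) := (0%N, (q i0, (1 - q i0) / 2)).
pose run s := foldl (fun p j => nxt (p, j)) p0 s.
have run_good s : good (run s) /\ (run s).1 = size s.
  elim/last_ind: s => [|s j [IHg IHs]].
    by split=> //; split=> /=; [lra|lra|lra|exists i0].
  rewrite /run foldl_rcons size_rcons.
  by have [//|gn -> _ _ _] := nxtP (run s, j) _; rewrite /= IHs.
pose N s (k : nat) : set T := [set b | J b -> forall x, C b x ->
  (run s).2.1 <= x -> x < (run s).2.1 + natSinv R k -> False].
have [//|//|//||//|||g gP] := @selective_branch _ setT J N.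
- exact: small_selective.
- move=> s j k jk b Nb Jb x Cx rx xr; apply: (Nb Jb x Cx rx).
  by rewrite (lt_le_trans xr)// lerD2l natSinv_le.
- move=> s b Jb; have [[_ _ _ [m cm]] _] := run_good s.
  have /closedRP/(_ _ (Cq (n:=m) Jb))[e e0 eC] := closedC Jb.
  have [k ke] := natSinv_lt e0; exists k => // _ x Cx.
  rewrite cm => qx xq; apply: (eC x) Cx.
  by rewrite ltr_norml; apply/andP; split; lra.
pose c n := (run (mkseq g n)).2.1; pose r n := (run (mkseq g n)).2.2.
have cP n : [/\ 0 <= c n, 0 < r n & c n + r n <= 1].
  by have [[]] := run_good (mkseq g n).
have stp n : [/\ c n < c n.+1, c n.+1 + r n.+1 < c n + r n,
    c n.+1 + r n.+1 < c n + natSinv R (g n) &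
    q n < c n.+1 \/ c n.+1 + r n.+1 < q n].
  rewrite /c /r mkseqS /run foldl_rcons -/(run _).
  have [gs ss] := run_good (mkseq g n).
  have [//|_ _ h1 h2] := nxtP (run (mkseq g n), g n) _.
  rewrite ss size_mkseq /= => h3.
  split=> //; apply: lt_le_trans h2 _; rewrite lerD2l ge_min lexx ?orbT//.
have cmono i j : (i <= j)%N -> c i <= c j /\ c j + r j <= c i + r i.
  move=> /subnKC <-; elim: (j - i)%N => [|d [IH1 IH2]]; first by rewrite addn0.
  by rewrite addnS; have [h1 h2 _ _] := stp (i + d)%N; split; lra.
have cr i j : c i <= c j + r j.
  have [ci ri ?] := cP i; have [cj rj ?] := cP j.
  by have [/cmono[]|/ltnW/cmono[]] := leqP i j; lra.
pose x := sup (range c).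
have hub : has_ubound (range c) by exists (c 0%N + r 0%N) => _ [i _ <-].
have cx n : c n <= x by apply: ub_le_sup => //; exists n.
have xcr n : x <= c n + r n.
  by apply: ge_sup => [|_ [i _ <-]//]; exists (c 0%N), 0%N.
exists x; split.
- by have [c0 r0 cr0] := cP 0%N; have := cx 0%N; have := xcr 0%N; lra.
- move=> n; have [_ _ _ qn] := stp n; have := cx n.+1; have := xcr n.+1.
  by case: qn => ? ? ?; apply/eqP => xq; lra.
- move=> b Jb Cx; have [n /(_ Jb x Cx)] := gP b Jb; apply; first exact: cx.
  by have [_ _ h _] := stp n; apply: le_lt_trans (xcr n.+1) h.
Qed.
End small_avoid.

(** * A dominating family and the concentrated set *)

(* The order type of [I] is the dominating number, seen as an ordinal. *)
Lemma nonsmall_initial_segment :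
  exists (I : set (nat -> nat)) (W : rel (nat -> nat)),
  [/\ ~ small I, antisymmetric W &
      forall b, I b -> small [set c | ~~ W b c]].
Proof.
have nsmT : ~ small [set: nat -> nat].
  move=> /(_ id)[g gP]; have [n] := gP (fun n => (g n).+1) Logic.I.
  by rewrite ltnn.
have [W woW] := wochoice.well_ordering_principle (nat -> nat : choiceType).
(* If [W b c] and [W c b], both are least elements of the pair, and least elements are unique. *)
have antiW : antisymmetric W.
  move=> b c /andP[bc cb].
  have [|z [_ zuniq]] := woW [pred d | (d == b) || (d == c)].
    by exists b; rewrite inE eqxx.
  have rW d : W d d.
    have [|y [[/eqP -> yd] _]] := woW (pred1 d); first by exists d; exact: eqxx.
    by apply: yd; exact: eqxx.
  have <- : z = b.
    apply: zuniq; split; first by rewrite inE eqxx.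
    by move=> d; rewrite inE => /orP[]/eqP->.
  apply: zuniq; split; first by rewrite inE eqxx orbT.
  by move=> d; rewrite inE => /orP[]/eqP->.
(* [[set c | ~~ W b c]] is the set of strict predecessors of [b]. If all of these are small, the
   whole space serves as [I]; otherwise [I] is the first one that is not. *)
have [[b nb]|nex] := pselect (exists b, ~ small [set c | ~~ W b c]); last first.
  exists setT, W; split=> // b _; apply: contrapT => nb.
  by apply: nex; exists b.
have [|a [[/asboolP na amin] _]] :=
    woW [pred b | `[< ~ small [set c | ~~ W b c] >]].
  by exists b; exact/asboolP.
exists [set c | ~~ W a c], W; split=> // c ac; apply: contrapT => nc.
by move/negP: ac; apply; apply: amin; exact/asboolP.
Qed.

Lemma nonsmall_dominating (T : Type) (I : set T) : ~ small I ->
  exists f : T -> nat -> nat,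
    forall g, exists2 b, I b & forall n, (g n < f b n)%N.
Proof.
move=> nsm; apply: contrapT => nf; apply: nsm => f.
apply: contrapT => ng; apply: nf; exists f => g.
apply: contrapT => nb; apply: ng; exists g => b Ib.
apply: contrapT => nn; apply: nb; exists b => // n.
by rewrite ltnNge; apply/negP => fg; apply: nn; exists n.
Qed.

Section concentrated_set.
Variable R : realType.

(** Indices that code no rational of [0,1] get the value 0, so every value lies in [0,1]. *)
Definition rat01 (n : nat) : R :=
  if unpickle n is Some r then
    if 0 <= (ratr r : R) <= 1 then ratr r else 0
  else 0.

Lemma rat01_itv n : 0 <= rat01 n <= 1.
Proof.
rewrite /rat01; case: unpickle => [r|]; last by rewrite lexx ler01.
by case: ifPn => //; rewrite lexx ler01.
Qed.

Lemma rat01_dense (a b : R) : 0 <= a -> a < b -> b <= 1 ->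
  exists2 n, a < rat01 n & rat01 n < b.
Proof.
move=> a0 ab b1; have [r] := rat_in_itvoo ab; rewrite in_itv/= => /andP[ar rb].
exists (pickle r); rewrite /rat01 pickleK;
  by rewrite (le_trans a0 (ltW ar)) (le_trans (ltW rb) b1).
Qed.

Lemma concentrated_set : exists (T : Type) (I : set T) (x : T -> R),
  [/\ ~ small I, forall c, I c -> 0 <= x c <= 1,
      forall c n, I c -> x c != rat01 n &
      forall C : set R, closed C -> (forall n, ~ C (rat01 n)) ->
        small [set c | I c /\ C (x c)]].
Proof.
have [I [W [nsmI antiW smW]]] := nonsmall_initial_segment.
have [f fP] := nonsmall_dominating nsmI.
pose C b := [set x : R | forall n, natSinv R (f b n) <= `|x - rat01 n|].
have closedC b : closed (C b).
  apply/closedRP => x /existsNP[n /negP]; rewrite -ltNge => xn.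
  exists (natSinv R (f b n) - `|x - rat01 n|); first by rewrite subr_gt0.
  move=> y xy /(_ n); apply/negP; rewrite -ltNge.
  by have := ler_distD x y (rat01 n); rewrite (distrC y x); lra.
have Cq b n : ~ C b (rat01 n).
  by move=> /(_ n); rewrite subrr normr0 leNgt natSinv_gt0.
have /choice[x xP] c : exists x : R, I c -> [/\ 0 <= x <= 1,
    forall n, x != rat01 n & forall b, ~~ W c b -> ~ C b x].
  have [Ic|nIc] := pselect (I c); last by exists 0.
  have [b _|b n _|x ?] := small_avoid rat01_dense (C := C) (smW _ Ic).
  - exact: closedC.
  - exact: Cq.
  - by exists x.
exists (nat -> nat), I, x; split=> //.
- by move=> c /xP[].
- by move=> c n /xP[].
- move=> D closedD Dq.
  have /choice[g gP] n :
      exists k, forall y, D y -> natSinv R k <= `|y - rat01 n|.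
    move/closedRP : closedD => /(_ _ (Dq n))[e e0 eD].
    have [k ke] := natSinv_lt e0; exists k => y Dy; rewrite leNgt.
    apply/negP => yk; apply: (eD y) Dy.
    by rewrite distrC (lt_trans yk).
  (* Domination puts [D] inside [C b], so [x c] in [D] rules out that [b] strictly precedes [c].
     Only [b] and its predecessors remain, a small set. *)
  have [b Ib gb] := fP g.
  apply: (sub_small _ (smallU (smW _ Ib) (small1 b))) => c [Ic Dc].
  have [bc|nbc] := boolP (W b c); [right|by left].
  apply: antiW; rewrite bc andbT; apply: contrapT => /negP ncb.
  have [_ _ /(_ b ncb)] := xP _ Ic; apply => n.
  by apply: le_trans (gP n _ Dc); apply: natSinv_le; exact: ltnW.
Qed.
End concentrated_set.

(** * The concentrated set: Menger property and failure of sigma-compactness *)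

Lemma decreasing_closed_nonempty (R : realType) (K : set R) (S : nat -> set R) :
  compact K -> (forall n, closed (S n)) -> (forall n, S n !=set0) ->
  (forall n, S n `<=` K) -> (forall m n, (m <= n)%N -> S n `<=` S m) ->
  \bigcap_n S n !=set0.
Proof.
move=> cK cS /choice[y Sy] SK dS.
have [|z [_ zy]] := cK (y @ \oo) _.
  by exists 0%N => // n _; exact: SK (Sy n).
exists z => n _; apply: cS => B Bz; apply: zy => //.
by exists n => // m /= nm; exact: dS nm _ (Sy m).
Qed.

Section concentrated.
Variables (R : realType) (T : Type) (I : set T) (x : T -> R).
Hypothesis nsmI : ~ small I.
Hypothesis x01 : forall c, I c -> 0 <= x c <= 1.
Hypothesis xq : forall c n, I c -> x c != rat01 R n.
Hypothesis closed_small : forall C : set R, closed C ->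
  (forall n, ~ C (rat01 R n)) -> small [set c | I c /\ C (x c)].

Let Y : set R := range (@rat01 R) `|` x @` I.

(** The even covers are spent on the rationals. What the selected sets miss is closed and contains
    no rational, so it holds few points [x c], which the odd covers handle. *)
Lemma concentrated_menger : menger Y.
Proof.
move=> U openU monoU coverU.
have /choice[g gq] n : exists k, U n.*2 k (rat01 R n).
  have [|k _ Uk] := coverU n.*2 (rat01 R n); last by exists k.
  by left; exists n.
pose D := ~` \bigcup_n U n.*2 (g n).
have closedD : closed D by apply: open_closedC; apply: bigcup_open.
have smD : small [set c | I c /\ D (x c)].
  by apply: closed_small => // n; apply; exists n.
have [//|n j k jk c|n c [Ic _]|h hP] := small_selective smD
    (U := fun n k => [set c | U n.*2.+1 k (x c)]).
- exact: monoU.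
- by have [|k _ Uk] := coverU n.*2.+1 (x c); [right; exists c|exists k].
exists (fun n => if odd n then h n./2 else g n./2) => y Yy.
have [[n _ Uny]|nV] := pselect ((\bigcup_n U n.*2 (g n)) y).
  by exists n.*2 => //=; rewrite odd_double doubleK.
case: Yy nV => [[n _ <-] []|[c Ic <-] nV]; first by exists n.
have [n _ Un] := hP c (conj Ic nV).
by exists n.*2.+1 => //=; rewrite odd_double /= uphalf_double.
Qed.

(** A sigma-ideal containing the singletons; it replaces countability in a perfect set argument. *)
Let null (S : set R) := small [set c | I c /\ S (x c)].

Lemma sub_null S S' : S `<=` S' -> null S' -> null S.
Proof. by move=> SS'; apply: sub_small => c [Ic /SS']. Qed.

Lemma null_bigcup (S : nat -> set R) :
  (forall n, null (S n)) -> null (\bigcup_n S n).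
Proof.
move=> nS; apply: (sub_small _ (small_bigcup nS)) => c [Ic [n _ Sn]].
by exists n.
Qed.

Lemma nullU S S' : null S -> null S' -> null (S `|` S').
Proof.
move=> nS nS'; apply: (sub_small _ (smallU nS nS')) => c [Ic [?|?]].
  by left.
by right.
Qed.

Lemma null1 z : null [set z].
Proof.
have [[n zn]|nz] := pselect (exists n, z = rat01 R n).
  move=> f; exists (fun=> 0%N) => c [Ic] /= xz.
  by have := xq n Ic; rewrite xz zn eqxx.
by apply: closed_small; [exact: closed_eq|move=> n zn; apply: nz; exists n].
Qed.

(** [sup E] is the cut up to which [S] stays null. [S] is null strictly below it by countable unions
    and at it by [null1], so [S] is non-null beyond [v = sup E + natSinv R n] for some [n]; [u] is
    taken halfway. *)
Lemma split_nonnull S : ~ null S -> exists u v,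
  [/\ u < v, ~ null (S `&` [set y | y <= u]) & ~ null (S `&` [set y | v <= y])].
Proof.
move=> nnS; pose E := [set t | null (S `&` [set y | y <= t])].
have E0 : E !=set0.
  exists (-1) => f; exists (fun=> 0%N) => c [Ic [_ /= xc]].
  by have := x01 Ic; lra.
have ubE : has_ubound E.
  exists 1 => t Et; rewrite leNgt; apply/negP => t1; apply: nnS.
  apply: sub_small Et => c [Ic Sc]; split=> //; split=> //=.
  by have := x01 Ic; lra.
have null_lt : null (S `&` [set y | y < sup E]).
  have : null (\bigcup_n (S `&` [set y | y <= sup E - natSinv R n])).
    apply: null_bigcup => n.
    have [|t Et lt_t] := @sup_gt _ E (sup E - natSinv R n) E0.
      by rewrite ltrBlDr ltrDl natSinv_gt0.
    by apply: sub_null Et => y [Sy /= yt]; split=> //=; lra.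
  apply: sub_null => y [Sy /= yE].
  have /natSinv_lt[n nE] : 0 < sup E - y by rewrite subr_gt0.
  by exists n => //; split=> //=; lra.
have [[n nn]|all_null] := pselect (exists n,
    ~ null (S `&` [set y | sup E + natSinv R n <= y])).
  have n0 := natSinv_gt0 R n.
  exists (sup E + natSinv R n / 2), (sup E + natSinv R n).
  split=> //; first lra.
  by move=> /(ub_le_sup ubE); lra.
exfalso; apply: nnS.
have null_gt : null (\bigcup_n (S `&` [set y | sup E + natSinv R n <= y])).
  by apply: null_bigcup => n; apply: contrapT => nn; apply: all_null; exists n.
apply: sub_null (nullU (nullU null_lt null_gt) (null1 (sup E))) => y Sy.
have [yE|Ey|->] := ltgtP y (sup E); [by left; left|left; right|by right].
have /natSinv_lt[n nE] : 0 < y - sup E by rewrite subr_gt0.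
by exists n => //; split=> //=; lra.
Qed.

Lemma nonnull_away S z : ~ null S ->
  exists2 e : R, 0 < e & ~ null (S `&` [set y | e <= `|y - z|]).
Proof.
move=> nnS; apply: contrapT => ne; apply: nnS.
have nullz : null (\bigcup_n (S `&` [set y | natSinv R n <= `|y - z|])).
  apply: null_bigcup => n; apply: contrapT => nn; apply: ne.
  by exists (natSinv R n) => //; exact: natSinv_gt0.
apply: sub_null (nullU nullz (null1 z)) => y Sy.
have [->|yz] := eqVneq y z; [by right|left].
have /natSinv_lt[n nyz] : 0 < `|y - z| by rewrite normr_gt0 subr_eq0.
by exists n => //; split=> //=; exact: ltW.
Qed.

(** One step of the Cantor scheme: remove a neighbourhood of the [n]-th rational, then split the
    rest. *)
Lemma nonnull_split S n : closed S -> ~ null S -> exists S' : bool -> set R,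
  [/\ forall b, closed (S' b), forall b, ~ null (S' b), forall b, S' b `<=` S,
      forall b, ~ S' b (rat01 R n) & forall y, S' true y -> ~ S' false y].
Proof.
move=> cS /(nonnull_away (rat01 R n))[e e0].
set A := S `&` _ => /split_nonnull[u [v [uv nu nv]]].
have cA : closed A.
  apply: closedI => //; apply/closedRP => y /= /negP; rewrite -ltNge => ye.
  exists (e - `|y - rat01 R n|); first by rewrite subr_gt0.
  move=> w yw; apply/negP; rewrite -ltNge.
  by have := ler_distD y w (rat01 R n); rewrite (distrC w y); lra.
exists (fun b => A `&` if b then [set y | y <= u] else [set y | v <= y]).
split.
- by case; apply: closedI.
- by case.
- by move=> b y [[]].
- by move=> b [[_ /=]]; rewrite subrr normr0 leNgt e0.
- by move=> y [_ /= yu] [_ /= vy]; lra.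
Qed.

(** A non-null [K] carries a Cantor scheme whose branches [B t] are disjoint and nonempty. They lie
    in a closed set [P] missing the rationals, so each contains some [x c] with [c] from a small
    set. Decoding branches would map that small set onto Baire space, which is impossible. *)
Lemma concentrated_no_closed (K : set R) :
  closed K -> K `<=` `[0, 1] -> K `<=` Y -> null K.
Proof.
move=> cK K01 KY; apply: contrapT => nnK.
have /choice[nxt nxtP] (p : nat * set R) : exists S' : bool -> set R,
    closed p.2 -> ~ null p.2 ->
    [/\ forall b, closed (S' b), forall b, ~ null (S' b),
      forall b, S' b `<=` p.2, forall b, ~ S' b (rat01 R p.1) &
      forall y, S' true y -> ~ S' false y].
  have [[cS nS]|nn] := pselect (closed p.2 /\ ~ null p.2).
    by have [S' ?] := nonnull_split p.1 cS nS; exists S'.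
  by exists (fun=> set0) => cS nS; case: nn.
pose sch s := foldl (fun p b => (p.1.+1, nxt p b)) (0%N, K) s.
have sch_good s : [/\ (sch s).1 = size s, closed (sch s).2 & ~ null (sch s).2].
  elim/last_ind: s => [|s b [IHs IHc IHn]]; first by split.
  rewrite /sch foldl_rcons size_rcons -/(sch s) /= IHs.
  by have [h1 h2 _ _ _] := nxtP _ IHc IHn; split.
have schP s : [/\ forall b, (sch (rcons s b)).2 `<=` (sch s).2,
    forall b, ~ (sch (rcons s b)).2 (rat01 R (size s)) &
    forall y, (sch (rcons s true)).2 y -> ~ (sch (rcons s false)).2 y].
  have [ss sc sn] := sch_good s; have [_ _ h3 h4 h5] := nxtP _ sc sn.
  by split=> [b|b|]; rewrite /sch !foldl_rcons -/(sch s) //= -ss.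
pose B (t : nat -> bool) := \bigcap_n (sch (mkseq t n)).2.
have B_neq0 t : B t !=set0.
  have decr m n : (m <= n)%N -> (sch (mkseq t n)).2 `<=` (sch (mkseq t m)).2.
    move=> /subnKC <-; elim: (n - m)%N => [|d IH]; first by rewrite addn0.
    apply: subset_trans IH; rewrite addnS mkseqS.
    by have [h _ _] := schP (mkseq t (m + d)); exact: h.
  apply: (@decreasing_closed_nonempty _ `[0, 1]) => //.
  - exact: segment_compact.
  - by move=> n; have [] := sch_good (mkseq t n).
  - move=> n; apply: contrapT => ne; have [_ _ []] := sch_good (mkseq t n).
    move=> f; exists (fun=> 0%N) => c [Ic Sc]; exfalso.
    by apply: ne; exists (x c).
  - by move=> n; apply: subset_trans K01; exact: (decr 0%N n).
have B_inj t t' y : B t y -> B t' y -> t = t'.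
  move=> ty ty'.
  have eq_seq n : mkseq t n = mkseq t' n.
    elim: n => // n IH; have := ty n.+1 Logic.I; have := ty' n.+1 Logic.I.
    rewrite !mkseqS -IH; have [_ _ disj] := schP (mkseq t n).
    by case: (t n) (t' n) => -[] // /disj h /h.
  apply/funext => n; have := eq_seq n.+1; rewrite !mkseqS => /rcons_inj[].
  by [].
(* [P] is closed because each level of the scheme is a finite union. *)
pose P := \bigcap_n \bigcup_(s in [set: n.-tuple bool]) (sch s).2.
have PK : P `<=` K.
  by move=> y /(_ 0%N Logic.I)[s _]; rewrite (tuple0 s).
have BP t : B t `<=` P.
  by move=> y ty n _; exists [tuple of mkseq t n] => //; exact: ty.
have Pq n : ~ P (rat01 R n).
  move=> /(_ n.+1 Logic.I)[s _]; case/lastP: {s}(tval s) (size_tuple s) => //.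
  move=> s b; rewrite size_rcons => -[<-].
  by have [_ h _] := schP s; exact: h.
have smP : small [set c | I c /\ P (x c)].
  apply: closed_small => //; apply: closed_bigI => n _.
  apply: closed_bigcup => [|s _]; first exact: finite_finset.
  by have [] := sch_good s.
(* [code] embeds Baire space into Cantor space. *)
pose code (h : nat -> nat) k : bool :=
  if unpickle k is Some nm then h nm.1 == nm.2 else false.
have code_inj h h' : code h = code h' -> h = h'.
  move=> hh; apply/funext => n.
  have := congr1 (@^~ (pickle (n, h n))) hh.
  by rewrite /code !pickleK /= eqxx => /esym/eqP.
have /choice[f fP] c : exists h, forall h', B (code h') (x c) -> h = h'.
  have [[h Bh]|nh] := pselect (exists h, B (code h) (x c)).
    by exists h => h' /(B_inj _ _ _ Bh)/code_inj.
  by exists (fun=> 0%N) => h' Bh'; case: nh; exists h'.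
have [g gP] := smP f.
(* This branch codes a function above [g] at every coordinate, against [gP]. *)
have [y By] := B_neq0 (code (fun n => (g n).+1)).
have Py := BP _ _ By.
case: (KY _ (PK _ Py)) => [[n _ ny]|[c Ic cy]].
  by apply: (Pq n); rewrite ny.
rewrite -cy in By Py; have [n] := gP c (conj Ic Py).
by rewrite (fP _ _ By) ltnn.
Qed.

Lemma concentrated_not_sigma_closed (K : nat -> set R) :
  (forall n, closed (K n)) -> Y <> \bigcup_n K n.
Proof.
move=> cK YK; apply: nsmI.
have Y01 : Y `<=` `[0, 1].
  move=> _ [[n _ <-]|[c Ic <-]] /=; rewrite in_itv/=; first exact: rat01_itv.
  exact: x01.
have : null (\bigcup_n K n).
  apply: null_bigcup => n; apply: concentrated_no_closed => //.
    by apply: subset_trans Y01; rewrite YK => y Ky; exists n.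
  by rewrite YK => y Ky; exists n.
by rewrite -YK; apply: sub_small => c Ic; split=> //; right; exists c.
Qed.

End concentrated.

(** * Completely metrizable subspaces of the line *)

Lemma nbhs_set_typeP (R : realType) (X : set R) (a : set_type X)
    (W : set (set_type X)) : nbhs a W <->
  exists2 e : R, 0 < e &
    forall b : set_type X, `|set_val a - set_val b| < e -> W b.
Proof.
split=> [/nbhs_ballP[e e0 eW]|[e e0 eW]]; first by exists e => // b; apply: eW.
by apply/nbhs_ballP; exists e => // b; apply: eW.
Qed.

(* A completely metrizable subspace [X] is a G_delta set: at a point of every
   [V n], the trace on [X] of the neighbourhood filter is Cauchy for the
   complete metric. *)
Lemma complement_completely_metrizable (R : realType) (A X : set R) :
  closed A -> X `<=` A -> completely_metrizable R (set_type X) ->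
  exists K : nat -> set R, (forall n, closed (K n)) /\ A `\` X = \bigcup_n K n.
Proof.
move=> cA XA [M Mcomplete [f [g [fK gK cf cg]]]].
(* Membership in every [V n] means that [x] is in the closure of [X] and that [f] has oscillation
   zero at [x]. *)
pose V n := [set x : R |
  (exists a : set_type X, `|x - set_val a| < natSinv R n) /\
  exists2 e : R, 0 < e & exists m : M, forall a : set_type X,
    `|x - set_val a| < e -> ball m (natSinv R n) (f a)].
have oV n : open (V n).
  apply/openRP => x [[a xa] [e e0 [m xm]]].
  exists (Num.min (e / 2) (natSinv R n - `|x - set_val a|)).
    by rewrite lt_min divr_gt0// subr_gt0.
  move=> y; rewrite lt_min => /andP[xye xya]; split.
    by exists a; have := ler_distD x y (set_val a); rewrite (distrC y x); lra.
  exists (e / 2); first by rewrite divr_gt0.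
  exists m => b yb; apply: xm.
  by have := ler_distD y x (set_val b); lra.
exists (fun n => A `&` ~` V n); split=> [n|].
  by apply: closedI => //; exact: open_closedC.
rewrite -setI_bigcupr -setC_bigcap setDE; congr (_ `&` ~` _).
apply/seteqP; split=> [x Xx n _|x Vx].
  pose a : set_type X := exist _ x (mem_set Xx).
  split; first by exists a; rewrite subrr normr0 natSinv_gt0.
  have /nbhs_set_typeP[e e0 eP] : nbhs a (f @^-1` ball (f a) (natSinv R n)).
    apply: cf; apply: nbhsx_ballx; exact: natSinv_gt0.
  by exists e => //; exists (f a) => b ab; exact: eP.
pose F : set_system (set_type X) := [set W | exists2 e : R, 0 < e &
  forall a : set_type X, `|x - set_val a| < e -> W a].
have FF : ProperFilter F.
  split=> [[e e0 eW]|].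
    have [n ne] := natSinv_lt e0; have [[a xa] _] := Vx n Logic.I.
    exact: (eW a (lt_trans xa ne)).
  split=> [|W W' [e e0 eW] [e' e'0 eW']|W W' WW' [e e0 eW]].
  - by exists 1.
  - exists (Num.min e e'); first by rewrite lt_min e0.
    by move=> a; rewrite lt_min => /andP[/eW ? /eW' ?].
  - by exists e => // a /eW /WW'.
have [|y Fy] := Mcomplete (f @ F) _.
  apply/cauchy_exP => e e0; have [n ne] := natSinv_lt e0.
  have [_ [d d0 [m mP]]] := Vx n Logic.I.
  exists m; exists d => // a /mP; exact: le_ball (ltW ne) _.
(* [F] converges to [x] by construction, and to [g y] because [g] is continuous and inverse to
   [f]. *)
suff -> : x = set_val (g y) by exact: set_valP.
apply/eqP; rewrite -subr_eq0 -normr_eq0 eq_le normr_ge0 andbT.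
apply/ler_addgt0Pl => e e0; rewrite addr0.
pose B := [set b : set_type X | `|set_val (g y) - set_val b| < e / 2].
have [d d0 dP] : F (f @^-1` (g @^-1` B)).
  apply: Fy; apply: cg; apply/nbhs_set_typeP.
  by exists (e / 2) => //; rewrite divr_gt0.
have [n nlt] : exists n, natSinv R n < Num.min d (e / 2).
  by apply: natSinv_lt; rewrite lt_min d0 divr_gt0.
have [[a xa] _] := Vx n Logic.I; move: nlt; rewrite lt_min => /andP[nd ne].
have := dP a (lt_trans xa nd); rewrite /B /= fK => ya.
have := ler_distD (set_val a) x (set_val (g y)).
by rewrite (distrC (set_val a)); lra.
Qed.

(** * Hausdorff distance *)

Section hausdorff_close.
Variable R : realType.
Implicit Types (K L M : set R) (d e : R).

(** For nonempty compact sets: Hausdorff distance at most [e]. *)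
Definition hclose e K L :=
  (forall x, K x -> exists2 y, L y & `|x - y| <= e) /\
  (forall y, L y -> exists2 x, K x & `|x - y| <= e).

Lemma hclose_sym e K L : hclose e K L -> hclose e L K.
Proof.
by move=> [KL LK]; split=> [y /LK|x /KL][z ? ?]; exists z; rewrite // distrC.
Qed.

Lemma hclose_le d e K L : d <= e -> hclose d K L -> hclose e K L.
Proof.
move=> de [KL LK]; split=> [x /KL|y /LK][z zP zd]; exists z => //;
  exact: le_trans zd de.
Qed.

Lemma hclose_refl K : hclose 0 K K.
Proof. by split=> x Kx; exists x; rewrite // subrr normr0. Qed.

Lemma hclose_trans d e L K M : hclose d K L -> hclose e L M ->
  hclose (d + e) K M.
Proof.
move=> [KL LK] [LM ML].
split=> [x /KL[y /LM[z Mz yz] xy]|z /ML[y /LK[x Kx xy] yz]].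
  by exists z => //; have := ler_distD y x z; lra.
by exists x => //; have := ler_distD y x z; lra.
Qed.

End hausdorff_close.

(** * The Baire argument along a branch *)

Section menger_complement.
Variables (R : realType) (Y : set R) (C : set (set R)) (G : nat -> set (set R)).
Hypothesis mengerY : menger Y.
Hypothesis CK : forall K, C K -> [/\ closed K, K !=set0 & K `<=` `[0, 1] `\` Y].
Hypothesis closedC : forall L, compact L -> L !=set0 -> L `<=` `[0, 1] `\` Y ->
  (forall e, 0 < e -> exists2 K, C K & hclose e K L) -> C L.
Hypothesis denseG : forall n K e, C K -> 0 < e -> exists L,
  [/\ C L, hclose e K L &
      exists2 d, 0 < d & forall M, C M -> hclose d L M -> G n M].

(** [(n, (K, r))] is a stage, a member of [C] and a radius. The factor 4 makes all later
    displacements sum to at most [r / 3]; bounding the new radius by [natSinv R j] too lets the move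
    [j] control how far from [K] the limit can be. *)
Lemma menger_baire_step (p : nat * (set R * R)) (j : nat) :
  exists p' : nat * (set R * R), C p.2.1 /\ 0 < p.2.2 ->
  [/\ C p'.2.1 /\ 0 < p'.2.2, p'.1 = p.1.+1,
      hclose (Num.min (p.2.2 / 4) (natSinv R j)) p.2.1 p'.2.1,
      p'.2.2 <= Num.min (p.2.2 / 4) (Num.min (natSinv R j) (natSinv R p.1)) &
      forall M, C M -> hclose p'.2.2 p'.2.1 M -> G p.1 M].
Proof.
case: p => n [K r] /=.
have [[K_C r0]|nP] := pselect (C K /\ 0 < r); last by exists (n, (K, r)) => /nP.
have [|L [L_C KL [d d0 dP]]] :=
    denseG n (e := Num.min (r / 4) (natSinv R j)) K_C.
  by rewrite lt_min natSinv_gt0 divr_gt0.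
set m := Num.min (r / 4) (Num.min (natSinv R j) (natSinv R n)).
have m0 : 0 < m by rewrite !lt_min !natSinv_gt0 divr_gt0.
exists (n.+1, (L, Num.min d m)) => _; split=> //=.
- by rewrite lt_min d0.
- by rewrite ge_min lexx orbT.
- by move=> M M_C LM; apply: dP => //; apply: hclose_le LM; rewrite ge_min lexx.
Qed.

Lemma menger_baire K0 e0 : C K0 -> 0 < e0 ->
  exists L, [/\ C L, hclose e0 K0 L & forall n, G n L].
Proof.
move=> K0_C e00.
have /choice[nxt nxtP] : forall pj : (nat * (set R * R)) * nat, exists p', _ :=
  fun pj => menger_baire_step pj.1 pj.2.
pose run s := foldl (fun p j => nxt (p, j)) (0%N, (K0, e0)) s.
have run_good s : (C (run s).2.1 /\ 0 < (run s).2.2) /\ (run s).1 = size s.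
  elim/last_ind: s => [//|s j [IHg IHs]].
  rewrite /run foldl_rcons size_rcons.
  by have [//|gn -> _ _ _] := nxtP (run s, j) _; rewrite /= IHs.
(* After move [k] the limit stays within [3/2 * natSinv R k] of the current set, so it misses points
   farther away than [natSinv R k * 2]; the slack [d] makes [N s k] open. *)
pose N s (k : nat) : set R := [set y | exists2 d, 0 < d &
  forall x, (run s).2.1 x -> natSinv R k * 2 + d <= `|x - y|].
have [||||s k|s j k jk y [d d0 dP]|s y Yy|g gP] :=
    @selective_branch R open Y N.
- exact: openT.
- exact: openI.
- by move=> F oF; apply: bigcup_open.
- exact: mengerY.
- apply/openRP => y [d d0 dP]; exists (d / 2); first by rewrite divr_gt0.
  move=> z yz; exists (d / 2); first by rewrite divr_gt0.
  move=> x /dP; have := ler_distD z x y; rewrite (distrC z y); lra.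
- exists d => // x /dP; have := natSinv_le R jk; lra.
- have [[sC _] _] := run_good s; have [cK _ KY] := CK sC.
  move/closedRP : cK => /(_ y)[|e e0' eK]; first by move=> /KY[].
  have [k ke] : exists k, natSinv R k < e / 4.
    by apply: natSinv_lt; rewrite divr_gt0.
  exists k => //; exists (e / 2); first by rewrite divr_gt0.
  move=> x Kx; rewrite leNgt; apply/negP => xy; apply: (eK x) Kx.
  by rewrite distrC; lra.
pose K n := (run (mkseq g n)).2.1; pose r n := (run (mkseq g n)).2.2.
have KP n : [/\ C (K n), 0 < r n & K n `<=` `[0, 1]].
  have [[h1 h2] _] := run_good (mkseq g n); have [_ _ h3] := CK h1.
  by split=> // x /h3[].
have r0 n : 0 < r n by have [] := KP n.
have stp n : [/\ hclose (Num.min (r n / 4) (natSinv R (g n))) (K n) (K n.+1),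
    r n.+1 <= r n / 4, r n.+1 <= natSinv R (g n), r n.+1 <= natSinv R n &
    forall M, C M -> hclose (r n.+1) (K n.+1) M -> G n M].
  rewrite /K /r mkseqS /run foldl_rcons -/(run _).
  have [gs ss] := run_good (mkseq g n).
  have [//|_ _ h1] := nxtP (run (mkseq g n), g n) _.
  by rewrite /= ss size_mkseq !le_min => /and3P[? ? ?] h2; split.
(* Displacements are at most a quarter of the radius and radii shrink by a factor 4, so the sum
   telescopes. *)
have chain n m : hclose ((r n - r (n + m)%N) / 3) (K n) (K (n + m)%N).
  elim: m => [|m IH]; first by rewrite addn0 subrr mul0r; exact: hclose_refl.
  have [h1 h2 _ _ _] := stp (n + m)%N; rewrite addnS.
  have h3 : hclose (r (n + m)%N / 4) (K (n + m)%N) (K (n + m).+1).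
    by apply: hclose_le h1; rewrite ge_min lexx.
  by apply: hclose_le (hclose_trans IH h3); have := r0 (n + m)%N; lra.
(* The topological upper limit of the [K n]; [KL] shows that it is their Hausdorff limit. *)
pose L := [set x : R | forall e, 0 < e -> forall i, exists m z,
  [/\ (i <= m)%N, K m z & `|x - z| < e]].
have cL : closed L.
  apply/closedRP => x nLx; apply: contrapT => ne; apply: nLx => e e0' i.
  apply: contrapT => nz; apply: ne; exists (e / 2); first by rewrite divr_gt0.
  move=> y xy /(_ (e / 2) _ i)[|m [z [im Kz yz]]]; first by rewrite divr_gt0.
  apply: nz; exists m, z; split=> //.
  by have := ler_distD y x z; lra.
have L01 : L `<=` `[0, 1].
  move=> x Lx; rewrite /= in_itv/=.
  have xe e : 0 < e -> - e <= x <= 1 + e.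
    move=> /Lx/(_ 0%N)[m [z [_ Kz]]]; have [_ _ /(_ z Kz)] := KP m.
    by rewrite /= in_itv/= ltr_norml; lra.
  apply/andP; split; apply/ler_addgt0Pr => e /xe; lra.
have compL : compact L.
  by apply: subclosed_compact L01 => //; exact: segment_compact.
have KL n : hclose (r n / 2) (K n) L.
  have rn0 := r0 n; split=> [z Kz|x Lx]; last first.
    have [|m [z [nm Kz xz]]] := Lx (r n / 6) _ n; first by rewrite divr_gt0.
    have [_ /(_ z)[|y Ky yz]] := chain n (m - n)%N; first by rewrite subnKC.
    exists y => //; move: yz; rewrite subnKC// => yz.
    by have := ler_distD z y x; rewrite (distrC z x); have := r0 m; lra.
  (* Points of the later sets near [z] have a cluster point, which lies in [L]. *)
  have /choice[y yP] m : exists y, K (n + m)%N y /\ `|z - y| <= r n / 3.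
    have [/(_ z Kz)[y Ky zy] _] := chain n m; exists y; split=> //.
    by have := r0 (n + m)%N; lra.
  have [|x [_ xy]] := @segment_compact R 0 1 (y @ \oo) _.
    exists 0%N => // m _; have [_ _ K01] := KP (n + m)%N.
    by have [/K01] := yP m.
  have cl e i : 0 < e -> exists m, (i <= m)%N /\ `|x - y m| < e.
    move=> e0'; have [||w [[m [im <-]] mw]] :=
      xy [set y m | m in [set m | (i <= m)%N]] (ball x e).
    - by exists i => // m im; exists m.
    - exact: nbhsx_ballx.
    - by exists m.
  exists x.
    move=> e e0' i; have [m [im xm]] := cl e i e0'.
    exists (n + m)%N, (y m); split=> //; last by have [] := yP m.
    exact: leq_trans im (leq_addl _ _).
  have [|m [_ xm]] := cl (r n / 6) 0%N; first by rewrite divr_gt0.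
  have [_ ym] := yP m.
  by have := ler_distD (y m) z x; rewrite (distrC (y m) x); lra.
have L0 : L !=set0.
  have [K_C _ _] := KP 0%N; have [_ [z Kz] _] := CK K_C.
  by have [/(_ z Kz)[x Lx _] _] := KL 0%N; exists x.
have LY : L `<=` `[0, 1] `\` Y.
  move=> y Ly; split; [exact: L01|move=> Yy].
  have [n [d d0 dP]] := gP y Yy.
  have [h1 h2 h3 _ _] := stp n.
  have [_ /(_ y Ly)[x' Kx' x'y]] := KL n.+1.
  have [_ /(_ x' Kx')[x Kx]] := h1; rewrite le_min => /andP[_ xx'].
  have := dP x Kx; have := ler_distD x' x y; have := r0 n.+1; lra.
have L_C : C L.
  apply: closedC => // e e0'; have [n ne] := natSinv_lt e0'.
  have [_ _ _ rn _] := stp n; exists (K n.+1); first by have [] := KP n.+1.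
  by apply: hclose_le (KL n.+1); have := r0 n.+1; lra.
exists L; split=> //.
  by apply: hclose_le (KL 0%N); rewrite /r /=; lra.
move=> n; have [_ _ _ _] := stp n; apply => //.
by apply: hclose_le (KL n.+1); have := r0 n.+1; lra.
Qed.

End menger_complement.

(** * Vietoris neighbourhoods and Hausdorff distance *)

Section trace.
Variables (R : realType) (X : set R).
Local Notation XT := (set_type X).

Definition real_trace (K : hyperspace XT) : set R := set_val @` (set_val K).

Lemma hyperspaceP (K : hyperspace XT) : compact (set_val K) /\ set_val K !=set0.
Proof. exact: (set_valP K). Qed.

Lemma real_trace_compact (K : hyperspace XT) : compact (real_trace K).
Proof.
apply: continuous_compact; last by have [] := hyperspaceP K.
by apply: continuous_subspaceT; exact: initial_continuous.
Qed.

Lemma real_trace_neq0 (K : hyperspace XT) : real_trace K !=set0.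
Proof. by have [_ [a Ka]] := hyperspaceP K; exists (set_val a), a. Qed.

Lemma real_trace_sub (K : hyperspace XT) : real_trace K `<=` X.
Proof. by move=> _ [a _ <-]; exact: set_valP. Qed.

(** Otherwise pairs at distance tending to 0 have first entry in [K] and second outside [W]; near a
    cluster point of the first entries, some second entry falls into [W]. *)
Lemma compact_lebesgue (K W : set XT) : compact K -> open W -> K `<=` W ->
  exists2 e : R, 0 < e &
    forall a b : XT, K a -> `|set_val a - set_val b| < e -> W b.
Proof.
move=> cK oW KW; apply: contrapT => ne.
have /choice[p pP] n : exists p : XT * XT, [/\ K p.1,
    `|set_val p.1 - set_val p.2| < natSinv R n & ~ W p.2].
  apply: contrapT => np; apply: ne.
  exists (natSinv R n); first exact: natSinv_gt0.
  move=> a b Ka ab; apply: contrapT => nW; apply: np.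
  by exists (a, b).
have [|a [Ka clp]] := cK ((fst \o p) @ \oo) _.
  by exists 0%N => // n _; have [] := pP n.
have /nbhs_set_typeP[e e0 eW] : nbhs a W.
  by apply: open_nbhs_nbhs; split=> //; exact: KW.
have [i ie] : exists i, natSinv R i < e / 2.
  by apply: natSinv_lt; rewrite divr_gt0.
have [||_ [[n /= im <-]] an] := clp [set (p n).1 | n in [set n | (i <= n)%N]]
    [set b | `|set_val a - set_val b| < e / 2].
- by exists i => // n im; exists n.
- by apply/nbhs_set_typeP; exists (e / 2) => //; rewrite divr_gt0.
have [_ pn nW] := pP n; apply: nW; apply: eW.
have := natSinv_le R im.
have := ler_distD (set_val (p n).1) (set_val a) (set_val (p n).2).
by move: an => /=; lra.
Qed.

Lemma uniform_positive (n : nat) (P : nat -> R -> Prop) :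
  (forall i d e, d <= e -> P i e -> P i d) ->
  (forall i, (i <= n)%N -> exists2 e : R, 0 < e & P i e) ->
  exists2 e : R, 0 < e & forall i, (i <= n)%N -> P i e.
Proof.
move=> Pd; elim: n => [|n IH] Pe.
  by have [e e0 Pe0] := Pe 0%N (leqnn _); exists e => // -[|].
have [i im|e e0 eP] := IH; first by apply: Pe; exact: leqW.
have [d d0 dP] := Pe n.+1 (leqnn _).
exists (Num.min d e); first by rewrite lt_min d0.
move=> i; rewrite leq_eqVlt => /orP[/eqP->|im].
  by apply: Pd dP; rewrite ge_min lexx.
by apply: Pd (eP i im); rewrite ge_min lexx orbT.
Qed.

(** A Lebesgue number handles the covering condition, and a ball around one point of [K] in each
    [U i] the meeting conditions. *)
Lemma open_hclose (A : set (hyperspace XT)) K : open A -> A K ->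
  exists2 e : R, 0 < e &
    forall L, hclose e (real_trace K) (real_trace L) -> A L.
Proof.
move=> /open_vietoris oA /oA[n [U [oU [KU KUi] UA]]].
have [cK _] := hyperspaceP K.
have [e e0 eP] := compact_lebesgue cK (bigcup_open oU) KU.
have [d d0 dP] : exists2 d : R, 0 < d & forall i, (i <= n)%N ->
    exists2 a : XT, set_val K a &
      forall b : XT, `|set_val a - set_val b| < d -> U i b.
  apply: uniform_positive => [i d1 d2 d12 [a Ka aU]|i im].
    by exists a => // b ab; apply: aU; exact: lt_le_trans ab d12.
  have [a [Ka Ua]] := KUi i im.
  have /nbhs_set_typeP[d d0 dU] : nbhs a (U i).
    by apply: open_nbhs_nbhs; split=> //; exact: oU.
  by exists d => //; exists a.
(* Halving turns the weak inequality of [hclose] into a strict one. *)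
exists (Num.min d e / 2); first by rewrite divr_gt0// lt_min d0.
have lt_m : Num.min d e / 2 < Num.min d e.
  by rewrite ltr_pdivrMr// ltr_pMr ?lt_min ?d0// ltr1n.
move=> L [KL LK]; apply: UA; split=> [b Lb|i im].
  have [_ [a Ka <-] ab] :
      exists2 x, real_trace K x & `|x - set_val b| <= Num.min d e / 2.
    by apply: LK; exists b.
  apply: (eP a b Ka); apply: le_lt_trans ab _; apply: lt_le_trans lt_m _.
  by rewrite ge_min lexx orbT.
have [a Ka aU] := dP i im.
have [_ [b Lb <-] ab] :
    exists2 y, real_trace L y & `|set_val a - y| <= Num.min d e / 2.
  by apply: KL; exists a.
exists b; split=> //; apply: aU; apply: le_lt_trans ab _.
apply: lt_le_trans lt_m _.
by rewrite ge_min lexx.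
Qed.

(** Finitely many cells of diameter at most [e] cover [X]; the Vietoris set of those that meet [K]
    is the neighbourhood. *)
Lemma hclose_open K (e : R) : X `<=` `[0, 1] -> 0 < e ->
  exists A : set (hyperspace XT), [/\ open A, A K &
    forall L, A L -> hclose e (real_trace K) (real_trace L)].
Proof.
move=> X01 e0; have [n ne] : exists n, natSinv R n < e / 2.
  by apply: natSinv_lt; rewrite divr_gt0.
pose cell i := [set a : XT | `|set_val a - i%:R * natSinv R n| < natSinv R n].
have ocell i : open (cell i).
  rewrite openE => a ai; apply/nbhs_set_typeP.
  exists (natSinv R n - `|set_val a - i%:R * natSinv R n|).
    by rewrite subr_gt0.
  move=> b ab; rewrite /cell/=.
  by have := ler_distD (set_val a) (set_val b) (i%:R * natSinv R n);
    rewrite (distrC (set_val b) (set_val a)); lra.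
have cell_cover a : exists2 i, (i <= n.+1)%N & cell i a.
  have := X01 _ (set_valP a); rewrite /= in_itv/= => /andP[a0 a1].
  have N0 : 0 < n.+1%:R :> R by [].
  have /truncn_itv : 0 <= set_val a * n.+1%:R by rewrite mulr_ge0.
  set i := Num.truncn _ => /andP[ia ai]; exists i.
    by rewrite -(ler_nat R) (le_trans ia)// ler_piMl// ltW.
  rewrite /cell/= -{1}(mulfK (lt0r_neq0 N0) (set_val a)) -mulrBl.
  rewrite normrM [`|_^-1|]gtr0_norm ?invr_gt0// gtr_pMl ?natSinv_gt0//.
  by rewrite ger0_norm ?subr_ge0// ltrBlDr addrC natr1.
have cell_close i a b : cell i a -> cell i b -> `|set_val a - set_val b| <= e.
  rewrite /cell/= => ai bi.
  have := ler_distD (i%:R * natSinv R n) (set_val a) (set_val b).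
  by rewrite (distrC (i%:R * natSinv R n)); lra.
have [_ [a0 Ka0]] := hyperspaceP K.
have [i0 i0n i0a] := cell_cover a0.
(* Cells that miss [K] are replaced by a cell that meets it, which keeps the index range fixed. *)
pose U i := if pselect (set_val K `&` cell i !=set0) then cell i else cell i0.
have oU i : open (U i) by rewrite /U; case: pselect => ?; exact: ocell.
have KU i : set_val K `&` U i !=set0.
  by rewrite /U; case: pselect => [//|?]; exists a0.
have Uclose i b :
    U i b -> exists2 a, set_val K a & `|set_val a - set_val b| <= e.
  move=> Ub; have [a [Ka Ua]] := KU i; exists a => //.
  by move: Ua Ub; rewrite /U; case: pselect => ?; apply: cell_close.
exists (vietoris_base n.+1 U); split.
- by apply/open_vietoris => L LU; exists n.+1, U; split.
- split=> // a Ka; have [i im ai] := cell_cover a; exists i => //.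
  by rewrite /U; case: pselect => //; case; exists a.
- move=> L [LU LUi]; split=> [_ [a Ka <-]|_ [b Lb <-]].
    have [i im ai] := cell_cover a; have [b [Lb]] := LUi i im.
    rewrite /U; case: pselect => [? bi|[]]; last by exists a.
    by exists (set_val b); [exists b|exact: cell_close ai bi].
  have [i _ /Uclose[a Ka ab]] := LU b Lb.
  by exists (set_val a) => //; exists a.
Qed.

Lemma real_trace_surj (S : set R) : compact S -> S !=set0 -> S `<=` X ->
  exists K : hyperspace XT, real_trace K = S.
Proof.
move=> cS [s Ss] SX; pose S' : set XT := set_val @^-1` S.
have S'P : compact S' /\ S' !=set0.
  split; last by exists (exist _ s (mem_set (SX s Ss))).
  move=> F FF FS'; have [|t [St clt]] := cS (set_val @ F) _; first exact: FS'.
  exists (exist _ t (mem_set (SX t St))); split=> //.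
  move=> A B FA /nbhs_set_typeP[e e0 eB].
  have [||_ [[a Aa <-] ta]] := clt (set_val @` A) (ball t e).
  - by rewrite /= nbhs_simpl/=; apply: (filterS _ FA) => a Aa; exists a.
  - exact: nbhsx_ballx.
  - by exists a; split=> //; apply: eB.
exists (exist _ S' (mem_set S'P)); apply/seteqP; split=> [_ [a Sa <-]//|t St].
by exists (exist _ t (mem_set (SX t St))).
Qed.

Lemma closed_hclose (C : set (hyperspace XT)) K : closed C ->
  (forall e : R, 0 < e ->
    exists2 L, C L & hclose e (real_trace L) (real_trace K)) ->
  C K.
Proof.
move=> cC KC; apply: contrapT => nCK.
have [e e0 eC] := open_hclose (closed_openC cC) nCK.
by have [L CL /hclose_sym/eC] := KC e e0.
Qed.

End trace.

(** * Hereditary Baireness and conclusion *)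

(** The whole space, itself open and dense, pads the enumeration when [F] is finite or empty. *)
Lemma countable_sequence (T : Type) (F : set (set T)) : countable F ->
  exists V : nat -> set T, (forall n, F (V n) \/ V n = setT) /\
    forall U, F U -> exists n, V n = U.
Proof.
move=> /countable_injP[f finj].
have /choice[V VP] n : exists U : set T, (F U \/ U = setT) /\
    forall U', F U' -> f U' = n -> U = U'.
  have [[U [FU fU]]|nU] := pselect (exists U, F U /\ f U = n).
    exists U; split=> [|U' FU' fU']; first by left.
    by apply: finj; rewrite ?inE// fU.
  exists setT; split=> [|U FU fU]; first by right.
  by case: nU; exists U.
exists V; split=> [n|U FU]; first by have [] := VP n.
by exists (f U); have [_] := VP (f U); exact.
Qed.

Lemma open_set_typeP (T : topologicalType) (C : set T) (U : set (set_type C)) :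
  open U -> exists2 V : set T, open V & set_val @^-1` V = U.
Proof. by move=> [V oV VU]; exists V. Qed.

Lemma menger_hereditarily_baire (R : realType) (Y : set R) : menger Y ->
  hereditarily_baire (hyperspace (set_type (`[0, 1] `\` Y))).
Proof.
move=> mY; set X := `[0, 1] `\` Y => C cC F cF FP O [K0 OK0] oO.
have X01 : X `<=` `[0, 1] by move=> ? [].
have [V [VF FV]] := countable_sequence cF.
have VP n : open (V n) /\ dense (V n).
  case: (VF n) => [/FP//|->]; split; first exact: openT.
  by move=> A [a Aa] _; exists a.
pose CR : set (set R) := [set real_trace K | K in C].
(* Quantifying over all [K] with trace [S] makes membership in [G n] apply to whichever [K]
   represents [S]. *)
pose G n : set (set R) :=
  [set S | forall K : set_type C, real_trace (set_val K) = S -> V n K].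
have open_near (W : set (set_type C)) (K : set_type C) : open W -> W K ->
    exists2 e : R, 0 < e & forall L : set_type C,
      hclose e (real_trace (set_val K)) (real_trace (set_val L)) -> W L.
  move=> /open_set_typeP[A oA <-] AK.
  have [e e0 eA] := open_hclose oA AK; exists e => // L; exact: eA.
have [e0 e00 e0O] := open_near O K0 oO OK0.
have [|L cL L0 LX LC|n _ e [K CK <-] e_gt0|||S [[M CM <-] K0M GM]] :=
    @menger_baire R Y CR G mY _ _ _ (real_trace (set_val K0)) e0.
- move=> _ [K _ <-]; split; last exact: real_trace_sub.
    by apply: compact_closed; [exact: Rhausdorff|exact: real_trace_compact].
  exact: real_trace_neq0.
- have [M ML] := real_trace_surj cL L0 LX; exists M => //.
  apply: (closed_hclose cC) => e /LC[_ [K CK <-] KL]; exists K => //.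
  by rewrite ML.
- have [A [oA AK AP]] := hclose_open K X01 e_gt0.
  have [oV dV] := VP n.
  have [||L [/= AL VL]] := dV (set_val @^-1` A).
  + by exists (exist _ K (mem_set CK)).
  + by exists A.
  exists (real_trace (set_val L)); split.
  + by exists (set_val L) => //; exact: set_valP.
  + exact: AP.
  + have [d d0 dV'] := open_near (V n) L oV VL; exists d => // _ [M CM <-] LM.
    by move=> K' K'M; apply: dV'; rewrite K'M.
- by exists (set_val K0) => //; exact: set_valP.
- exact: e00.
pose M' : set_type C := exist _ M (mem_set CM).
exists M'; split; first exact: e0O.
by move=> U /FV[n <-]; exact: (GM n M').
Qed.

Theorem corollary3p6 (R : realType) :
  exists X : set R,
    [/\ X `<=` `[0, 1],
        ~ polish R (set_type X)
      & hereditarily_baire (hyperspace (set_type X))].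
Proof.
have [T [I [x [nsmI x01 xq closed_small]]]] := concentrated_set R.
pose Y := range (@rat01 R) `|` x @` I.
exists (`[0, 1] `\` Y); split; first by move=> ? [].
- move=> [_ /complement_completely_metrizable].
  move=> /(_ `[0, 1]%classic)[||K [cK YK]].
  + exact: interval_closed.
  + by move=> ? [].
  apply: (concentrated_not_sigma_closed nsmI x01 xq closed_small cK).
  rewrite -YK setDD; apply/esym/setIidPr => _ [[n _ <-]|[c Ic <-]] /=;
    rewrite in_itv/=; [exact: rat01_itv|exact: x01].
- by apply: menger_hereditarily_baire; exact: concentrated_menger.
Qed.
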